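(* Let $(\mathfrak{g},\omega)$ be a symplectic Lie algebra, let $\varphi$ be a derivation of $\mathfrak{g}$ and let $\lambda\in\mathfrak{g}^*$ be such that $\omega_{\varphi,\varphi}(x,y)=\lambda([x,y])$ for all $x,y\in\mathfrak{g}$. Let $\zeta\in\mathfrak{g}$ be the element with $\lambda=\omega(\zeta,\cdot)$. Then the central symplectic oxidation $\langle\xi\rangle\oplus\mathfrak{g}\oplus\langle h\rangle$ of $(\mathfrak{g},\omega)$ with respect to $(\varphi,\lambda)$ is a symplectic Novikov Lie algebra (SNLA) if $(\mathfrak{g},\omega)$ is an SNLA and the following properties hold: 1. $\varphi\circ \mathrm{L}_x=\mathrm{ad}_x\circ\varphi^*$ and $\mathrm{R}_x\circ\varphi^*=\mathrm{L}_{\varphi^*(x)}$ for all $x\in\mathfrak{g}$; 2. $\mathrm{R}_x\circ(\varphi+\varphi^* )=(\varphi+\varphi^* )\circ\mathrm{R}_x$ for all $x\in\mathfrak{g}$; 3. $\varphi\circ\varphi^*=0$, $\mathrm{ad}_\zeta=\varphi^2$ and $\zeta\in\ker(\varphi)$.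
   Context: A symplectic Lie algebra $(\mathfrak{g},\omega)$ is a finite-dimensional real Lie algebra with a skew-symmetric non-degenerate bilinear form $\omega$ satisfying $\omega([x,y],z)+\omega([y,z],x)+\omega([z,x],y)=0$. The left-symmetric product associated with $(\mathfrak{g},\omega)$ is the bilinear product defined by $\omega(x.y,z)=-\omega(y,[x,z])$; it is known to be left-symmetric with $x.y-y.x=[x,y]$. $(\mathfrak{g},\omega)$ is an SNLA if this product is Novikov: $(x.y).z=(x.z).y$ for all $x,y,z$. On $\mathfrak{g}$, $\mathrm{L}_xy=x.y$ and $\mathrm{R}_xy=y.x$ denote left and right multiplications for this product, $\mathrm{ad}_xy=[x,y]$, and for an endomorphism $f$ of $\mathfrak{g}$, $f^*$ is the symplectic adjoint: $\omega(f(x),y)=\omega(x,f^*(y))$ for all $x,y$. For a derivation $\varphi$ of $\mathfrak{g}$ set $\omega_\varphi(x,y)=\omega(\varphi x,y)+\omega(x,\varphi y)$ and $\omega_{\varphi,\varphi}(x,y)=\omega_\varphi(\varphi x,y)+\omega_\varphi(x,\varphi y)$. Let $\lambda\in\mathfrak{g}^*$ satisfy $\omega_{\varphi,\varphi}(x,y)=\lambda([x,y])$ for all $x,y\in\mathfrak{g}$. The central symplectic oxidation of $(\mathfrak{g},\omega)$ with respect to $(\varphi,\lambda)$ is the symplectic Lie algebra $(\mathfrak{g}_2,\Omega)$, where $\mathfrak{g}_2=\langle\xi\rangle\oplus\mathfrak{g}\oplus\langle h\rangle$ as a vector space ($\langle\xi\rangle,\langle h\rangle$ one-dimensional), with Lie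 bracket $[x,y]_{\mathfrak{g}_2}=[x,y]+\omega_\varphi(x,y)h$ and $[\xi,x]_{\mathfrak{g}_2}=\varphi(x)+\lambda(x)h$ for $x,y\in\mathfrak{g}$, $h$ central, and with $\Omega(x,y)=\omega(x,y)$, $\Omega(\xi,x)=\Omega(h,x)=0$ for $x,y\in\mathfrak{g}$, $\Omega(\xi,h)=1$. *)

(* Defs.v *)
From HB Require Import structures.
From mathcomp Require Import all_boot all_order all_algebra.
From mathcomp Require Import boolp classical_sets reals.

Set Implicit Arguments.
Unset Strict Implicit.
Unset Printing Implicit Defensive.

Import GRing.Theory.
Local Open Scope ring_scope.

Section SymplecticLie.
Variables (R : realType) (g : vectType R).
Variables (br : g -> g -> g) (om : g -> g -> R).

Record lie_bracket : Prop := LieBracket {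
  lie_bilinear : bilinear_for *:%R *:%R br;
  lie_alternating : forall x, br x x = 0;
  lie_jacobi : forall x y z, br x (br y z) + br y (br z x) + br z (br x y) = 0
}.

Record symplectic_lie : Prop := SymplecticLie {
  sympl_lie : lie_bracket;
  sympl_bilinear : bilinear_for *%R *%R om;
  sympl_skew : forall x y, om x y = - om y x;
  sympl_nondegenerate : forall x, (forall y, om x y = 0) -> x = 0;
  sympl_closed : forall x y z,
    om (br x y) z + om (br y z) x + om (br z x) y = 0
}.

Definition derivation (phi : g -> g) : Prop :=
  forall x y, phi (br x y) = br (phi x) y + br x (phi y).

(* The element x.y determined by om (x.y) z = - om y [x, z]; existence is
   [ls_prodP], uniqueness is non-degeneracy. *)
Definition ls_prod (x y : g) : g :=
  xget 0 [set u | forall z, om u z = - om y (br x z)]%classic.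

Definition lmul (x : g) : g -> g := fun y => ls_prod x y.
Definition rmul (x : g) : g -> g := fun y => ls_prod y x.

(* The symplectic adjoint f^*: om (f x) y = om x (f^* y); existence for linear
   f is [sadjP]. *)
Definition sadj (f : g -> g) : g -> g := fun y =>
  xget 0 [set u | forall x, om (f x) y = om x u]%classic.

Definition novikov : Prop :=
  forall x y z, ls_prod (ls_prod x y) z = ls_prod (ls_prod x z) y.

Definition SNLA : Prop := symplectic_lie /\ novikov.

(* om_phi; iterating gives om_{phi,phi} = dform phi (dform phi om). *)
Definition dform (phi : g -> g) (b : g -> g -> R) : g -> g -> R :=
  fun x y => b (phi x) y + b x (phi y).

Lemma flat_surj (f : g -> R) : symplectic_lie -> scalar f ->
  exists u, forall z, om u z = f z.
Proof.
move=> [_ [oml omr] _ ond _] lf.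
pose G (h : g -> R) (lh : scalar h) : {linear g -> R^o} :=
  HB.pack (h : g -> R^o) (GRing.isLinear.Build _ _ _ _ (h : g -> R^o) lh).
pose F0 (x : g) : 'Hom(g, R^o) := linfun (G _ (omr x)).
have lF0 : linear F0.
  by move=> a x y; apply/lfunP=> z; rewrite add_lfunE scale_lfunE !lfunE /= oml.
pose F1 : {linear g -> 'Hom(g, R^o)} :=
  HB.pack F0 (GRing.isLinear.Build _ _ _ _ F0 lF0).
pose F := linfun F1.
have kF : lker F == 0%VS.
  apply/lker0P=> x y; rewrite !lfunE /= => Fxy.
  apply/eqP; rewrite -subr_eq0; apply/eqP/ond => z.
  have := congr1 (fun h : 'Hom(g, R^o) => h z) Fxy; rewrite !lfunE /= => e.
  by rewrite addrC -scaleN1r oml /= e mulN1r addNr.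
have : limg F = fullv.
  apply/eqP; rewrite eqEdim subvf /= limg_dim_eq ?(eqP kF) ?capv0 //.
  by rewrite !dimvf /dim /= muln1.
move=> imF; have /memv_imgP [u _ Fu] : linfun (G f lf) \in limg F.
  by rewrite imF memvf.
exists u => z; have := congr1 (fun h : 'Hom(g, R^o) => h z) Fu.
by rewrite !lfunE /= => ->.
Qed.

Lemma ls_prodP x y z : symplectic_lie ->
  om (ls_prod x y) z = - om y (br x z).
Proof.
move=> S; have [[[_ brr] _ _] [_ omr] _ _ _] := S.
have [|w Hw] := @flat_surj (fun z => - om y (br x z)) S.
  by move=> a u v; rewrite brr omr opprD mulrN.
exact: (@xgetI _ 0
  [set u | forall t, om u t = - om y (br x t)]%classic w Hw z).
Qed.

Lemma sadjP (f : {linear g -> g}) x y : symplectic_lie ->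
  om (f x) y = om x (sadj f y).
Proof.
move=> S; have [_ [oml _] sk _ _] := S.
have [|u Hu] := @flat_surj (fun x => - om (f x) y) S.
  by move=> a v w; rewrite linearP oml opprD mulrN.
have Pu z : om (f z) y = om z u by rewrite (sk z) Hu opprK.
exact: (@xgetI _ 0
  [set v | forall t, om (f t) y = om t v]%classic u Pu x).
Qed.

End SymplecticLie.

Section Oxidation.
Variables (R : realType) (g : vectType R).
Variables (br : g -> g -> g) (om : g -> g -> R).
Variables (phi : g -> g) (lam : g -> R).

(* The triple (a, x, b) stands for a *: xi + x + b *: h. *)
Definition oxidation : vectType R := (R^o * g * R^o)%type.

Definition ox_bracket (X Y : oxidation) : oxidation :=
  let: (a, x, _) := X in let: (a', x', _) := Y in
  (0, br x x' + a *: phi x' - a' *: phi x,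
   dform phi om x x' + a * lam x' - a' * lam x).

Definition ox_form (X Y : oxidation) : R :=
  let: (a, x, b) := X in let: (a', x', b') := Y in
  om x x' + a * b' - b * a'.

End Oxidation.

(* Main.v *)
(* Write psi for the symplectic adjoint of phi and S = phi + psi, so that
   om_phi x y = om x (S y), and let x.y be the left-symmetric product of g.
   The left-symmetric product (a, x, b).(a', y, b') of the oxidation is
     (0, x.y - a psi y - a' S x - a a' zeta, - om y (phi x) - a' om zeta x).
   After multiplication on the right by (c, z, d), the Novikov identity is
   invariance under exchanging (a', y) and (c, z).  The g-component is
   invariant by the Novikov identity of g, condition 2, R_x psi = L_(psi x),
   and zeta.z = - psi^2 z = - S (psi z), the adjoint form of ad_zeta = phi^2.
   For the h-component one uses om z (phi (x.y)) = om y (phi (x.z)) and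
   om z (phi^2 x) = - om zeta (x.z).  Identities between vectors are tested by
   pairing with om, which turns them into ring identities in R. *)
Require Import Defs.
From HB Require Import structures.
From mathcomp Require Import all_boot all_order all_algebra.
From mathcomp Require Import reals ring.

Set Implicit Arguments.
Unset Strict Implicit.
Unset Printing Implicit Defensive.

Import GRing.Theory.
Local Open Scope ring_scope.

(** * Rules of calculation from a proof of linearity *)

Section LinearFor.
Variables (R : pzRingType) (U : lmodType R) (V : zmodType).
Variables (s : GRing.Scale.law R V) (f : U -> V).
Hypothesis lf : GRing.linear_for s f.

Let F : {linear U -> V | s} :=
  HB.pack f (GRing.isLinear.Build _ _ _ _ f lf).

Lemma linear_forD u v : f (u + v) = f u + f v.
Proof. exact: (raddfD F). Qed.

Lemma linear_forN u : f (- u) = - f u.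
Proof. exact: (raddfN F). Qed.

Lemma linear_for0 : f 0 = 0.
Proof. exact: (raddf0 F). Qed.

Lemma linear_forZ a u : f (a *: u) = s a (f u).
Proof. exact: (linearZ_LR F). Qed.

End LinearFor.

(** * Calculus of [om], [br] and the symplectic adjoint *)

Section SymplecticLieTheory.
Variables (R : realType) (g : vectType R).
Variables (br : g -> g -> g) (om : g -> g -> R).
Hypothesis S : symplectic_lie br om.

Let oml y : scalar (om^~ y) := (sympl_bilinear S).1 y.
Let omr x : scalar (om x) := (sympl_bilinear S).2 x.
Let brl y : linear (br^~ y) := (lie_bilinear (sympl_lie S)).1 y.
Let brr x : linear (br x) := (lie_bilinear (sympl_lie S)).2 x.

(** One tuple of rules, so that a single [rewrite !] expands [om] in both arguments before
    [ring]. *)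
Lemma sympl_formE :
  ((forall x x' y, om (x + x') y = om x y + om x' y)%R *
   (forall x y, om (- x) y = - om x y)%R *
   (forall a x y, om (a *: x) y = a * om x y)%R *
   (forall y, om 0 y = 0)%R *
   (forall x y y', om x (y + y') = om x y + om x y')%R *
   (forall x y, om x (- y) = - om x y)%R *
   (forall a x y, om x (a *: y) = a * om x y)%R *
   (forall x, om x 0 = 0)%R)%type.
Proof.
do !split.
- by move=> x x' y; exact: (linear_forD (oml y)).
- by move=> x y; exact: (linear_forN (oml y)).
- by move=> a x y; exact: (linear_forZ (oml y)).
- by move=> y; exact: (linear_for0 (oml y)).
- by move=> x; exact: (linear_forD (omr x)).
- by move=> x; exact: (linear_forN (omr x)).
- by move=> a x; exact: (linear_forZ (omr x)).
- by move=> x; exact: (linear_for0 (omr x)).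
Qed.

Lemma sympl_bracketE :
  ((forall x x' y, br (x + x') y = br x y + br x' y)%R *
   (forall x y, br (- x) y = - br x y)%R *
   (forall a x y, br (a *: x) y = a *: br x y)%R *
   (forall y, br 0 y = 0)%R *
   (forall x y y', br x (y + y') = br x y + br x y')%R *
   (forall x y, br x (- y) = - br x y)%R *
   (forall a x y, br x (a *: y) = a *: br x y)%R *
   (forall x, br x 0 = 0)%R)%type.
Proof.
do !split.
- by move=> x x' y; exact: (linear_forD (brl y)).
- by move=> x y; exact: (linear_forN (brl y)).
- by move=> a x y; exact: (linear_forZ (brl y)).
- by move=> y; exact: (linear_for0 (brl y)).
- by move=> x; exact: (linear_forD (brr x)).
- by move=> x; exact: (linear_forN (brr x)).
- by move=> a x; exact: (linear_forZ (brr x)).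
- by move=> x; exact: (linear_for0 (brr x)).
Qed.

Lemma sympl_form_inj x y : om x =1 om y -> x = y.
Proof.
move=> exy; apply/subr0_eq/(sympl_nondegenerate S) => z.
by rewrite !sympl_formE exy subrr.
Qed.

Lemma lie_skew x y : br x y = - br y x.
Proof.
have alt := lie_alternating (sympl_lie S).
have := alt (x + y); rewrite !sympl_bracketE !alt add0r addr0 => /eqP.
by rewrite addr_eq0 => /eqP.
Qed.

Lemma sympl_closedE x y z :
  om (br x y) z = - om (br y z) x - om (br z x) y.
Proof.
apply/eqP; rewrite -subr_eq0 opprD !opprK addrA; apply/eqP.
exact: (sympl_closed S).
Qed.

Lemma ls_prod_unique x y u :
  (forall z, om u z = - om y (br x z)) -> ls_prod br om x y = u.
Proof. by move=> eu; apply: sympl_form_inj => z; rewrite eu ls_prodP. Qed.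

Lemma sadjK (f : {linear g -> g}) x y :
  om (sadj om f x) y = om x (f y).
Proof. by rewrite (sympl_skew S) -(sadjP f _ _ S) -(sympl_skew S). Qed.

End SymplecticLieTheory.

Lemma scaler_regular (R : pzRingType) (k : R) (a : R^o) : k *: a = k * a.
Proof. by []. Qed.

(** * The oxidation as a symplectic Lie algebra and its left-symmetric product *)

Section CentralOxidation.
Variables (R : realType) (g : vectType R).
Variables (br : g -> g -> g) (om : g -> g -> R).
Variables (phi : {linear g -> g}) (lam : {scalar g}) (zeta : g).
Hypothesis S : symplectic_lie br om.
Hypothesis hder : derivation br phi.
Hypothesis hlam :
  forall x y, dform phi (dform phi om) x y = lam (br x y).
Hypothesis hzeta : forall x, lam x = om zeta x.

Let omE := sympl_formE S.
Let brE := sympl_bracketE S.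
Let phiE := (linearD phi, linearN phi, linearZZ phi).
Let lamE := (linearD lam, linearN lam, scalarZ lam).

Lemma oxidation_lie : lie_bracket (ox_bracket br om phi lam).
Proof.
split.
- split=> [[[a y] b]|[[a y] b]] k [[a1 x1] b1] [[a2 x2] b2].
  + congr (_, _, _) => /=.
    * by rewrite /= scaler0 addr0.
    * apply: (sympl_form_inj S) => z.
      rewrite /= scaler_regular !brE !(phiE, lamE) !omE; ring.
    * rewrite /= !scaler_regular /dform !(phiE, lamE) !omE; ring.
  + congr (_, _, _) => /=.
    * by rewrite /= scaler0 addr0.
    * apply: (sympl_form_inj S) => z.
      rewrite /= scaler_regular !brE !(phiE, lamE) !omE; ring.
    * rewrite /= !scaler_regular /dform !(phiE, lamE) !omE; ring.
- move=> [[a x] b].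
  congr (_, _, _) => /=.
    by rewrite (lie_alternating (sympl_lie S)) add0r subrr.
  by rewrite /dform (sympl_skew S (phi x)) addNr add0r subrr.
- move=> [[a x] b] [[a' y] b'] [[a'' z] b''].
  have J : br x (br y z) = - br y (br z x) - br z (br x y).
    apply/eqP; rewrite -subr_eq0 opprD !opprK addrA; apply/eqP.
    exact: (lie_jacobi (sympl_lie S)).
  congr (_, _, _) => /=.
  + by rewrite !addr0.
  + apply: (sympl_form_inj S) => w.
    rewrite /= !scale0r !subr0 !brE !(phiE, lamE) /= !hder J !omE.
    rewrite (lie_skew S (phi x) y) (lie_skew S (phi y) z).
    rewrite (lie_skew S (phi z) x) !omE.
    ring.
  (* Terms free of xi cancel by closedness of [om] on triples such as y, z, phi x; terms linear in
     xi cancel by [hlam]. *)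
  + have C := sympl_closedE S.
    have K := sympl_skew S.
    rewrite /= !mul0r !subr0 /dform !(phiE, lamE) -!hlam /dform !hder !omE.
    rewrite (K (phi x) (br y z)) (K (phi y) (br z x)) (K (phi z) (br x y)).
    rewrite (C y z (phi x)) (C z x (phi y)) (C x y (phi z)).
    (* Each pairing gets a fixed order of arguments, so that [ring] sees equal atoms. *)
    rewrite !(K _ (br _ _)) !(K _ (phi (phi _))).
    rewrite (K (phi y) (phi x)) (K (phi z) (phi x)) (K (phi z) (phi y)).
    ring.
Qed.

Lemma oxidation_symplectic :
  symplectic_lie (ox_bracket br om phi lam) (ox_form om).
Proof.
split.
- exact: oxidation_lie.
- split=> [[[a y] b]|[[a y] b]] k [[a1 x1] b1] [[a2 x2] b2].
  + rewrite /= !scaler_regular !omE; ring.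
  + rewrite /= !scaler_regular !omE; ring.
- move=> [[a x] b] [[a' y] b'] /=; rewrite (sympl_skew S); ring.
- move=> [[a x] b] H.
  (* Pairing with h isolates [a], with - xi isolates [b], and with vectors of g isolates [x]. *)
  have a0 : a = 0.
    have := H (0, 0, 1); rewrite /= !omE => <-; ring.
  have b0 : b = 0.
    have := H (- 1, 0, 0); rewrite /= !omE => <-; ring.
  have x0 : x = 0.
    apply: (sympl_nondegenerate S) => z.
    have := H (0, z, 0); rewrite /= => <-; ring.
  by rewrite a0 b0 x0.
- move=> [[a x] b] [[a' y] b'] [[a'' z] b''] /=.
  (* The om_phi term of one bracket, paired with xi, cancels the [phi] terms of the other two. *)
  rewrite /dform !omE (sympl_closedE S) (sympl_skew S x (phi y)).
  rewrite (sympl_skew S y (phi z)) (sympl_skew S z (phi x)); ring.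
Qed.

(** Pairing with (c, z, d) determines the product: z tests its g-component and c its h-component. *)
Lemma oxidation_prodE a x b a' y b' :
  ls_prod (ox_bracket br om phi lam) (ox_form om) (a, x, b) (a', y, b') =
  (0, ls_prod br om x y - a *: sadj om phi y
      - a' *: (phi x + sadj om phi x) - (a * a') *: zeta,
   - (om y (phi x) + a' * om zeta x)).
Proof.
apply: (ls_prod_unique oxidation_symplectic) => -[[c z] d] /=.
rewrite /dform !omE !hzeta (ls_prodP _ _ _ S) !(sadjK S).
ring.
Qed.

End CentralOxidation.

Theorem theorem3 (R : realType) (g : vectType R)
    (br : g -> g -> g) (om : g -> g -> R)
    (phi : {linear g -> g}) (lam : {scalar g}) (zeta : g)
    (hsympl : symplectic_lie br om)
    (hder : derivation br phi)
    (hlam : forall x y, dform phi (dform phi om) x y = lam (br x y))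
    (hzeta : forall x, lam x = om zeta x)
    (hSNLA : SNLA br om)
    (h1l : forall x, phi \o lmul br om x =1 br x \o sadj om phi)
    (h1r : forall x, rmul br om x \o sadj om phi =1 lmul br om (sadj om phi x))
    (h2 : forall x, rmul br om x \o (phi \+ sadj om phi)
                    =1 (phi \+ sadj om phi) \o rmul br om x)
    (h3adj : forall x, phi (sadj om phi x) = 0)
    (h3ad : br zeta =1 phi \o phi)
    (h3ker : phi zeta = 0) :
  SNLA (ox_bracket br om phi lam) (ox_form om).
Proof.
split; first exact: oxidation_symplectic hder hlam.
move=> [[a x] b] [[a' y] b'] [[c z] d].
have S := hsympl; have omE := sympl_formE S; have brE := sympl_bracketE S.
have prodE := ls_prodP _ _ _ S; have adjE := sadjK S.
have adjP x y := sadjP phi x y S.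
rewrite !(oxidation_prodE hsympl hder hlam hzeta).
have h1l' u v : phi (ls_prod br om u v) = br u (sadj om phi v) := h1l u v.
congr (_, _, _).
- apply: (sympl_form_inj S) => w.
  have N : om z (br (ls_prod br om x y) w) = om y (br (ls_prod br om x z) w).
    by apply: oppr_inj; rewrite -!prodE hSNLA.2.
  have F1 : om z (br (sadj om phi y) w) = om y (br (sadj om phi z) w).
    by apply: oppr_inj; rewrite -!prodE; congr om; exact: h1r.
  (* This is (S x).t = S (x.t) paired with [w]; it matches a' (S x).z with the term a' S (x.z) of
     the exchanged product. *)
  have F2 t : om t (br (phi x) w) = - om t (br (sadj om phi x) w)
      - om (phi (ls_prod br om x t)) w - om (ls_prod br om x t) (phi w).
    have := congr1 (om^~ w) (h2 t x).
    rewrite /rmul /= !omE prodE !adjE !brE !omE => e.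
    by rewrite -[_ - _ - _]addrA -opprD -e; ring.
  rewrite !omE !prodE !adjE !brE !(linearD phi, linearN phi, linearZZ phi).
  (* As phi psi = 0, both zeta.y and - S (psi y) pair with [w] to - om y (phi (phi w)). *)
  rewrite !h3adj h3ker !omE !adjE.
  rewrite !prodE N F1 !F2 !h3ad /= !prodE.
  ring.
(* Since phi (x.y) = [x, psi y], the left side is - om (x.z) (psi y), that is - om (phi (x.z)) y. *)
- have G : om z (phi (ls_prod br om x y)) = om y (phi (ls_prod br om x z)).
    rewrite h1l'; apply: oppr_inj.
    by rewrite -prodE -adjP (sympl_skew S).
  (* Here phi^2 x = - [x, zeta], so zeta serves as test vector for x.t. *)
  have H t : om t (phi (phi x)) = - om zeta (ls_prod br om x t).
    rewrite -[phi _]h3ad (sympl_skew S zeta) opprK prodE.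
    by rewrite (lie_skew S zeta) omE.
  have Z t : om zeta (sadj om phi t) = 0 by rewrite -adjP h3ker omE.
  rewrite !(linearD phi, linearN phi, linearZZ phi) !h3adj h3ker !omE !Z G !H.
  ring.
Qed.
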